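(* Consider the linear divergence-free vector field $\mathbf{a}(x)=(a_i(x))_{i=1}^3$, $a_i(x)=a_{i1}x_1+a_{i2}x_2+a_{i3}x_3$, on $\mathbb{R}^3$, with $a_{11}+a_{22}+a_{33}=0$, and the class $S_1$ generating one-form $\lambda=\phi\,dx_1+\Phi\,dX_1$. Both of the following choices of $(\phi,\Phi)$ yield first-order volume preserving integrators for $\dot{x}=\mathbf{a}(x)$ with time step $\Delta t$, provided that $a_{13}\neq0$. (i) $$\phi(x_1,X_1,x_2)=\frac{X_1-x_1-\Delta t\,a_{11}x_1-\Delta t^2a_{21}a_{12}x_1\frac{k_2}{k_1}}{\Delta t\,a_{13}+\Delta t^2a_{23}a_{12}\frac{k_2}{k_1}}\,x_2-\frac{a_{12}}{k_1a_{13}+\Delta t\,a_{23}a_{12}k_2}\,\frac{x_2^2}{2},$$ $$\Phi(x_1,X_1,X_2)=-\frac{X_1-x_1-\Delta t\,a_{11}x_1}{\Delta t\,a_{13}}(1+\Delta t\,a_{33})X_2+X_2^2\Big(-\frac{\Delta t\,a_{32}}{2}+\frac{a_{12}}{2a_{13}}(1+\Delta t\,a_{33})\Big)-\Delta t\,a_{31}X_1X_2-\frac{2X_1x_1-x_1^2(1+\Delta t\,a_{11})\Delta t\,a_{23}k_2+\Delta t^2a_{13}a_{21}k_2x_1^2}{2k_3},$$ where $k_1=1+\Delta t^2a_{11}a_{33}-\Delta t\,a_{22}$, $k_2=1+\Delta t^2\frac{a_{11}a_{33}}{1-\Delta t\,a_{22}}$, $k_3=\Delta t\,a_{13}\big(\Delta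 t\,a_{13}+\frac{k_2}{k_1}\Delta t\,a_{12}a_{23}\big)$. (ii) $$\phi(x_1,X_1,x_2)=\frac{X_1-(1+\Delta t\,a_{11})x_1}{\Delta t\,a_{13}}\,x_2-\frac12\frac{a_{12}}{a_{13}}x_2^2,$$ $$\Phi(x_1,X_1,X_2)=-\frac1{l_1}\Big((1+\Delta t\,a_{33})\Big(\frac{X_1-(1+\Delta t\,a_{11})x_1}{\Delta t\,a_{33}}X_2-\frac12\frac{a_{12}}{a_{13}}X_2^2\Big)+\Delta t\,a_{31}x_1X_2+\frac12\Delta t\,a_{32}X_2^2+\Delta t\frac{a_{12}}{a_{13}}\big(a_{21}x_1X_1+\tfrac12a_{22}X_2^2\big)\Big)+\Delta t\,a_{21}\frac{x_1^2}{2}+\Delta t\,a_{23}\frac{2X_1x_1-x_1^2(1+\Delta t\,a_{11})}{2\Delta t\,a_{13}},$$ where $l_1=1-\Delta t\frac{a_{12}}{a_{13}}a_{23}$.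
   Context: Class $S_1$ generating one-form: given functions $\phi$ of $(x_1,x_2,X_1)$ and $\Phi$ of $(x_1,X_1,X_2)$, the form $\lambda=\phi\,dx_1+\Phi\,dX_1$ generates the map $x=(x_1,x_2,x_3)\mapsto X=(X_1,X_2,X_3)$ defined implicitly by $$x_3=\partial_{x_2}\phi,\qquad \partial_{X_1}\phi=\partial_{x_1}\Phi,\qquad X_3=-\partial_{X_2}\Phi.$$ A first-order volume preserving integrator for $\dot x=\mathbf{a}(x)$ is such a map, depending on the time step $\Delta t$, that preserves the volume form $dx_1\wedge dx_2\wedge dx_3$ and is a consistent method of order one for the differential equation (in particular $(X-x)/\Delta t\to\mathbf{a}(x)$ as $\Delta t\to0$).
   Formalization: Misprints corrected. (i): 2X₁x₁−x₁²(1+Δt a₁₁) is parenthesized before Δt a₂₃k₂; k₃ has Δt²a₁₂a₂₃ in its inner factor. (ii): first denominator Δt a₁₃, not Δt a₃₃; a₂₁x₁X₂, not a₂₁x₁X₁; last two terms of Φ carry the factor −1/(l₁Δt a₁₃). *)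

(* Defs.v *)
From HB Require Import structures.
From mathcomp Require Import all_boot all_order all_algebra.
From mathcomp Require Import all_classical all_reals all_analysis.
Import Order.TTheory GRing.Theory Num.Theory.
Import numFieldNormedType.Exports.

Set Implicit Arguments.
Unset Strict Implicit.
Unset Printing Implicit Defensive.

Local Open Scope classical_set_scope.
Local Open Scope ring_scope.

(* The indices of the three coordinates; [o1], [o2], [o3] stand for 1, 2, 3. *)
Definition o1 : 'I_3 := Ordinal (isT : (0 < 3)%N).
Definition o2 : 'I_3 := Ordinal (isT : (1 < 3)%N).
Definition o3 : 'I_3 := Ordinal (isT : (2 < 3)%N).

Definition linear_field (R : realType) (A : 'M[R]_3) (x : 'rV[R]_3) : 'rV[R]_3 :=
  \row_i (A i o1 * x 0 o1 + A i o2 * x 0 o2 + A i o3 * x 0 o3).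

(* [phi] is a function of (x_1, X_1, x_2) and [Phi] one of (x_1, X_1, X_2), in
   this order of arguments.  The derivability clauses are there because
   [derive1] is a total operator. *)
Definition S1_relation (R : realType) (phi Phi : R -> R -> R -> R)
    (x X : 'rV[R]_3) : Prop :=
  let x1 := x 0 o1 in let x2 := x 0 o2 in let x3 := x 0 o3 in
  let X1 := X 0 o1 in let X2 := X 0 o2 in let X3 := X 0 o3 in
  [/\ derivable (fun t : R => phi x1 X1 t) x2 1,
      derivable (fun t : R => phi x1 t x2) X1 1,
      derivable (fun t : R => Phi t X1 X2) x1 1 &
      derivable (fun t : R => Phi x1 X1 t) X2 1] /\
  [/\ x3 = derive1 (fun t : R => phi x1 X1 t) x2,
      derive1 (fun t : R => phi x1 t x2) X1 = derive1 (fun t : R => Phi t X1 X2) x1 &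
      X3 = - derive1 (fun t : R => Phi x1 X1 t) X2].

(* The relation is the graph of [F]: every [x] has exactly one image. *)
Definition generates_S1 (R : realType) (phi Phi : R -> R -> R -> R)
    (F : 'rV[R]_3 -> 'rV[R]_3) : Prop :=
  forall x X, S1_relation phi Phi x X <-> X = F x.

(* The pull-back of dx_1 /\ dx_2 /\ dx_3 by [F] is the form itself. *)
Definition volume_preserving (R : realType) (F : 'rV[R]_3 -> 'rV[R]_3) : Prop :=
  forall x, differentiable F x /\ \det ('J F x) = 1.

Definition local_solution (R : realType) (a : 'rV[R]_3 -> 'rV[R]_3)
    (x : 'rV[R]_3) (y : R -> 'rV[R]_3) : Prop :=
  y 0 = x /\ \forall t \near (0 : R), derivable y t 1 /\ derive1 y t = a (y t).

Definition consistent (R : realType) (a : 'rV[R]_3 -> 'rV[R]_3)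
    (F : R -> 'rV[R]_3 -> 'rV[R]_3) : Prop :=
  forall x, h^-1 *: (F h x - x) @[h --> (0 : R)^'] --> a x.

(* The local error of one step is O(h^(p+1)). *)
Definition has_order (R : realType) (p : nat) (a : 'rV[R]_3 -> 'rV[R]_3)
    (F : R -> 'rV[R]_3 -> 'rV[R]_3) : Prop :=
  forall x y, local_solution a x y ->
    exists C : R, \forall h \near (0 : R)^', `|F h x - y h| <= C * `|h| ^+ p.+1.

(* [phi h] and [Phi h] are the generating functions for the time step [h]; they
   are required to define a map for all sufficiently small [h != 0]. *)
Definition yields_first_order_vp_integrator (R : realType)
    (a : 'rV[R]_3 -> 'rV[R]_3) (phi Phi : R -> R -> R -> R -> R) : Prop :=
  exists F : R -> 'rV[R]_3 -> 'rV[R]_3,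
    [/\ \forall h \near (0 : R)^', generates_S1 (phi h) (Phi h) (F h),
        \forall h \near (0 : R)^', volume_preserving (F h),
        consistent a F &
        has_order 1 a F].

Section GeneratingFunctions.
Context (R : realType) (A : 'M[R]_3) (h : R).

Local Notation a11 := (A o1 o1). Local Notation a12 := (A o1 o2).
Local Notation a13 := (A o1 o3). Local Notation a21 := (A o2 o1).
Local Notation a22 := (A o2 o2). Local Notation a23 := (A o2 o3).
Local Notation a31 := (A o3 o1). Local Notation a32 := (A o3 o2).
Local Notation a33 := (A o3 o3).

Definition k1 : R := 1 + h ^+ 2 * a11 * a33 - h * a22.
Definition k2 : R := 1 + h ^+ 2 * ((a11 * a33) / (1 - h * a22)).

(* The published formula has [h] instead of [h ^+ 2] in the inner factor.  That
   factor has to be the denominator of [phi_i]: otherwise the map is not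
   consistent, for instance when a12 = a13 = a23 = 1 and the other entries are
   zero. *)
Definition k3 : R := h * a13 * (h * a13 + k2 / k1 * (h ^+ 2 * a12 * a23)).

Definition phi_i (x1 X1 x2 : R) : R :=
  (X1 - x1 - h * a11 * x1 - h ^+ 2 * a21 * a12 * x1 * (k2 / k1))
    / (h * a13 + h ^+ 2 * a23 * a12 * (k2 / k1)) * x2
  - a12 / (k1 * a13 + h * a23 * a12 * k2) * (x2 ^+ 2 / 2).

(* In the last fraction the published formula omits the parentheses around
   [2 * X1 * x1 - x1 ^+ 2 * (1 + h * a11)]; without them the map is unbounded
   as h tends to 0, for instance when a13 = 1 and the other entries are zero. *)
Definition Phi_i (x1 X1 X2 : R) : R :=
  - ((X1 - x1 - h * a11 * x1) / (h * a13)) * (1 + h * a33) * X2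
  + X2 ^+ 2 * (- (h * a32 / 2) + a12 / (2 * a13) * (1 + h * a33))
  - h * a31 * X1 * X2
  - ((2 * X1 * x1 - x1 ^+ 2 * (1 + h * a11)) * (h * a23 * k2)
     + h ^+ 2 * a13 * a21 * k2 * x1 ^+ 2) / (2 * k3).

Definition l1 : R := 1 - h * (a12 / a13) * a23.

Definition phi_ii (x1 X1 x2 : R) : R :=
  (X1 - (1 + h * a11) * x1) / (h * a13) * x2 - 1 / 2 * (a12 / a13) * x2 ^+ 2.

(* Three corrections to the published formula, which does not give a consistent
   map (nor a map at all when a33 = 0):
   - the first denominator is [h * a13], not [h * a33];
   - the a21 term next to a22 is [a21 * x1 * X2], not [a21 * x1 * X1];
   - the last two terms, which are functions of (x1, X1) only, carry the factor
     [- 1 / (l1 * (h * a13))]; it is missing in print.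
   With them, the second equation of the map is
     X2 = x2 + h * (a21 * x1 + c * X2 + a23 * x3),   c = a22 + O(h). *)
Definition Phi_ii (x1 X1 X2 : R) : R :=
  - (1 / l1) *
    ((1 + h * a33) *
       ((X1 - (1 + h * a11) * x1) / (h * a13) * X2
        - 1 / 2 * (a12 / a13) * X2 ^+ 2)
     + h * a31 * x1 * X2 + 1 / 2 * h * a32 * X2 ^+ 2
     + h * (a12 / a13) * (a21 * x1 * X2 + 1 / 2 * a22 * X2 ^+ 2)
     + 1 / (h * a13) *
       (h * a21 * (x1 ^+ 2 / 2)
        + h * a23 * ((2 * X1 * x1 - x1 ^+ 2 * (1 + h * a11))
                     / (2 * h * a13)))).

End GeneratingFunctions.

(* Main.v *)
From HB Require Import structures.
Require Import Defs.
From mathcomp Require Import all_boot all_order all_algebra.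
From mathcomp Require Import all_classical all_reals all_analysis.
From mathcomp Require Import ring lra.
Import Order.TTheory GRing.Theory Num.Theory.
Import numFieldNormedType.Exports.

(* In both cases the three equations of the generating form are triangular in
   (X1, X2, X3), so they define an explicit linear map F_h.  In case (i),
     X2 = (x2 + h k2 (a21 x1 + a23 x3)) / k1,
     X1 = x1 + h (a11 x1 + a12 X2 + a13 x3),
     X3 = x3 + h (a31 X1 + a32 X2 + a33 x3),
   a composition of three one-variable updates with determinant
   (1 + h a11)(1 + h a33) / k1, and k1 = (1 + h a11)(1 + h a33) because the
   trace of A vanishes.  In case (ii) the same identity makes the determinant
   equal to 1.  An expansion F_h(x) = x + h A x + h^2 r(h), with r convergent
   at 0, gives consistency, and also the order, because every solution satisfies
   y(h) = x + h A x + O(h^2) by the mean value theorem. *)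

Set Implicit Arguments.
Unset Strict Implicit.
Unset Printing Implicit Defensive.

Local Open Scope classical_set_scope.
Local Open Scope ring_scope.

(** * Coordinates, determinants and volume preservation of linear maps *)

Lemma ord3P (i : 'I_3) : [\/ i = o1, i = o2 | i = o3].
Proof.
case: i => [[|[|[|//]]] H].
- by constructor 1; exact: val_inj.
- by constructor 2; exact: val_inj.
- by constructor 3; exact: val_inj.
Qed.

Lemma is_derive_quadratic (R : realType) (a b c : R) (f : R -> R) (t : R) :
  (forall s, f s = a + b * s + c * s ^+ 2) -> is_derive t 1 f (b + 2 * c * t).
Proof.
move=> fE; rewrite (_ : f = (fun s => a + b * s + c * s ^+ 2)); last exact/funext.
apply: is_derive_eq.
rewrite /GRing.scale /=; ring.
Qed.

Lemma det_mx33 (R : comRingType) (M : 'M[R]_3) :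
  \det M = M o1 o1 * (M o2 o2 * M o3 o3 - M o2 o3 * M o3 o2)
         - M o1 o2 * (M o2 o1 * M o3 o3 - M o2 o3 * M o3 o1)
         + M o1 o3 * (M o2 o1 * M o3 o2 - M o2 o2 * M o3 o1).
Proof.
rewrite (expand_det_row _ o1) !big_ord_recl big_ord0 /cofactor.
rewrite !(expand_det_row _ ord0) !big_ord_recl !big_ord0 /cofactor !det_mx11 !mxE.
(* Indexing by natural numbers lets the lifted ordinals of the cofactor expansion compute, so that
   [ring] recognises equal entries. *)
pose m i j := M (inord i) (inord j).
have Mm (i j : 'I_3) : M i j = m i j by rewrite /m !inord_val.
rewrite !{}Mm /= /bump /=; ring.
Qed.

(** A linear map is its own differential, so its Jacobian matrix at every point has the images of
    the basis vectors as rows. *)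
Lemma linear_volume_preserving (R : realType) (F : 'rV[R]_3 -> 'rV[R]_3) :
  linear F -> \det (\matrix_(i, j) F (delta_mx 0 i) 0 j) = 1 ->
  volume_preserving F.
Proof.
move=> linF detF x.
pose Fmix := GRing.isLinear.Build _ _ _ _ _ linF.
pose L : {linear _ -> _} := HB.pack F Fmix.
have dF z : differentiable F z.
  (* As a finite sum of coordinates times fixed vectors, [F] is differentiable, hence continuous,
     which [diff_lin] requires. *)
  have -> : F = \sum_j (fun v : 'rV[R]_3 => v 0 j *: F (delta_mx 0 j)).
    apply/funext => u; rewrite fct_sumE /=.
    transitivity (L (\sum_j u 0 j *: delta_mx 0 j)).
      by rewrite -row_sum_delta.
    rewrite linear_sum.
    by apply: eq_bigr => j _; rewrite linearZ.
  apply: differentiable_sum => j; apply: differentiableZl.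
  exact: differentiable_coord.
split; first exact: dF.
rewrite -[RHS]detF; congr (\det _).
have cF : continuous L by move=> z; apply: differentiable_continuous; exact: dF.
apply/matrixP => i j; rewrite /jacobian mxE (_ : 'd F x = F :> (_ -> _)).
  by rewrite mxE.
exact: (diff_lin x cF).
Qed.

(** * Second-order accuracy of the Euler step along a solution *)

Lemma derivable_lipschitz_at (R : realType) (f : R -> R) (x : R) :
  derivable f x 1 ->
  exists2 C, 0 <= C & \forall t \near (0 : R), `|f (t + x) - f x| <= C * `|t|.
Proof.
move=> /cvg_ex [l /= fl]; exists (`|l| + 1); first by rewrite addr_ge0.
have ltl : `|l| < `|l| + 1 by rewrite ltrDl.
have /= := cvgr_norm_le l fl _ ltl; rewrite near_withinE => H; near=> t.
have tl : t != 0 -> `|t^-1 *: (f (t *: 1 + x) - f x)| <= `|l| + 1.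
  by near: t; exact: H.
have [->|t0] := eqVneq t 0; first by rewrite add0r subrr normr0 mulr0.
move: (tl t0); rewrite /GRing.scale /= mulr1 normrM normfV.
by rewrite ler_pdivrMl ?normr_gt0// mulrC.
Unshelve. all: by end_near.
Qed.

(** By the mean value theorem the error is [h * (df u - c)] for some [u] between 0 and [h], and
    [df u - c] is itself O(h). *)
Lemma taylor_bound (R : realType) (f df : R -> R) (c C : R) : 0 <= C ->
  (\forall t \near (0 : R), is_derive (t : R) (1 : R) f (df t)) ->
  (\forall t \near (0 : R), `|df t - c| <= C * `|t|) ->
  \forall h \near (0 : R), `|f h - f 0 - h * c| <= C * `|h| ^+ 2.
Proof.
move=> C0 dfN cN.
have /nbhs_ballP[e /= e0 eP] : \forall t \near (0 : R),
    is_derive (t : R) (1 : R) f (df t) /\ `|df t - c| <= C * `|t| by near do split.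
have {}eP t : `|t| < e -> is_derive (t : R) (1 : R) f (df t) /\ `|df t - c| <= C * `|t|.
  by move=> te; apply: eP; rewrite /ball /= sub0r normrN.
(* A general segment covers both signs of the step: [[0, h]] when [h] is nonnegative, [[h, 0]] with
   length [- h] otherwise. *)
have key a b h : a <= b -> `|a| < e -> `|b| < e -> h = b - a ->
  (forall u, u \in `[a, b] -> `|u| <= h) ->
  `|f b - f a - h * c| <= C * h ^+ 2.
  move=> ab ae be hE uh.
  have se u : u \in `[a, b] -> `|u| < e.
    rewrite in_itv /= => /andP[au ub].
    by move: ae be; rewrite !ltr_norml => /andP[? ?] /andP[? ?]; lra.
  have [||u uab ->] := @MVT_segment _ f df _ _ ab.
  - by move=> u uab; apply eP, se, subset_itv_oo_cc.
  - apply: derivable_within_continuous => u /se /eP[d _]; exact: ex_derive.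
  have h0 : 0 <= h by rewrite hE subr_ge0.
  rewrite -hE (mulrC h) -mulrBl normrM (ger0_norm h0) expr2 mulrA ler_wpM2r//.
  have [_ /le_trans] := eP u (se _ uab); apply.
  by rewrite ler_wpM2l// uh.
near=> h.
have he : `|h| < e.
  have : ball (0 : R) e h by near: h; exact: nbhsx_ballx.
  by rewrite /ball /= sub0r normrN.
have oe : `|0 : R| < e by rewrite normr0.
have [h0|h0] := leP 0 h.
  rewrite (ger0_norm h0); apply: key => //; first by rewrite subr0.
  by move=> u; rewrite in_itv/= ler_norml; lra.
rewrite -normrN (ler0_norm (ltW h0)) (_ : - (f h - f 0 - h * c) = f 0 - f h - - h * c);
  last by ring.
apply: key => //; rewrite ?sub0r// ?ltW// => u.
by rewrite in_itv/= ler_norml; lra.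
Unshelve. all: by end_near.
Qed.

Lemma normr_rV_le (R : realType) n (v : 'rV[R]_n) (C : R) : 0 <= C ->
  (forall i, `|v 0 i| <= C) -> `|v| <= C.
Proof.
move=> C0 vC; rewrite [leLHS]/Num.Def.normr/= mx_normrE bigmax_le //= => -[i j] _.
by rewrite ord1.
Qed.

(** The norm is the largest entry, so the sum of the finitely many componentwise constants serves
    all entries. The filter is arbitrary because both full and punctured neighbourhoods of 0
    occur. *)
Lemma near_rV_le (R : realType) n (F : set_system R) {FF : Filter F}
    (f : R -> 'rV[R]_n) (g : R -> R) : (forall h, 0 <= g h) ->
  (forall i, exists2 C, 0 <= C & \forall h \near F, `|f h 0 i| <= C * g h) ->
  exists2 C, 0 <= C & \forall h \near F, `|f h| <= C * g h.
Proof.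
move=> g0 fC; pose C i := sval (cid2 (fC i)).
have C0 i : 0 <= C i by rewrite /C; case: cid2.
exists (\sum_i C i); first exact: sumr_ge0.
have fCF : \forall h \near F, forall i, `|f h 0 i| <= C i * g h.
  by apply: filter_forall => i; rewrite /C; case: cid2.
near=> h.
have fCh : forall i, `|f h 0 i| <= C i * g h by near: h.
apply: normr_rV_le => [|i].
  by rewrite mulr_ge0// sumr_ge0.
by rewrite (le_trans (fCh i))// ler_wpM2r// (bigD1 i)//= lerDl sumr_ge0.
Unshelve. all: by end_near.
Qed.

(** Derivability at 0 makes [y t - x] of size O(t). By linearity the velocity [linear_field A (y t)]
    is then also within O(t) of its initial value, and [taylor_bound] applies to each coordinate. *)
Lemma solution_expansion (R : realType) (A : 'M[R]_3) (x : 'rV[R]_3)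
    (y : R -> 'rV[R]_3) : local_solution (linear_field A) x y ->
  exists2 C, 0 <= C & \forall h \near (0 : R),
    `|y h - x - h *: linear_field A x| <= C * `|h| ^+ 2.
Proof.
move=> [y0 dy].
have [dy0 _] := nbhs_singleton dy.
have lip i : exists2 C, 0 <= C &
    \forall t \near (0 : R), `|y t 0 i - x 0 i| <= C * `|t|.
  have [C C0 H] := derivable_lipschitz_at ((derivable_mxP _ _ _).1 dy0 0 i).
  by exists C => //; apply: filterS H => t; rewrite addr0 y0.
apply: (@near_rV_le _ _ (nbhs (0 : R)) _ _ (fun h => `|h| ^+ 2)) => [h|i].
  exact: sqr_ge0.
have [[C1 C10 H1] [C2 C20 H2] [C3 C30 H3]] := And3 (lip o1) (lip o2) (lip o3).
pose C := `|A i o1| * C1 + `|A i o2| * C2 + `|A i o3| * C3.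
have C0 : 0 <= C by rewrite !addr_ge0// mulr_ge0.
exists C => //.
have : \forall h \near (0 : R),
      `|y h 0 i - y 0 0 i - h * linear_field A x 0 i| <= C * `|h| ^+ 2; last first.
  by apply: filterS => h; rewrite y0 !mxE.
apply: (@taylor_bound _ (fun t => y t 0 i) (fun t => linear_field A (y t) 0 i)) => //.
  apply: filterS dy => t [dyt yE]; split.
    exact: ((derivable_mxP _ _ _).1 dyt 0 i).
  by rewrite -yE derive1E derive_mx// mxE.
near=> t; rewrite !mxE.
rewrite (_ : _ - _ = A i o1 * (y t 0 o1 - x 0 o1) + A i o2 * (y t 0 o2 - x 0 o2)
  + A i o3 * (y t 0 o3 - x 0 o3)); last by ring.
rewrite /C !mulrDl -!mulrA; apply: le_trans (ler_normD _ _) _.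
apply: lerD; first (apply: le_trans (ler_normD _ _) _; apply: lerD).
- by rewrite normrM ler_wpM2l//; near: t.
- by rewrite normrM ler_wpM2l//; near: t.
- by rewrite normrM ler_wpM2l//; near: t.
Unshelve. all: by end_near.
Qed.

(** * Remainders that converge as the time step tends to 0 *)

Definition has_limit0 (R : realType) (f : R -> R) : Prop :=
  exists l : R, f h @[h --> (0 : R)^'] --> l.

Section HasLimit0.
Context (R : realType).
Implicit Types f g : R -> R.

Lemma has_limit0_cst (c : R) : has_limit0 (fun=> c).
Proof. by exists c; exact: cvg_cst. Qed.

Lemma has_limit0_id : has_limit0 (fun h : R => h).
Proof. by exists 0; exact: nbhs_dnbhs. Qed.

Lemma has_limit0D f g : has_limit0 f -> has_limit0 g ->
  has_limit0 (fun h => f h + g h).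
Proof. by move=> [a fa] [b gb]; exists (a + b); exact: cvgD. Qed.

Lemma has_limit0N f : has_limit0 f -> has_limit0 (fun h => - f h).
Proof. by move=> [a fa]; exists (- a); exact: cvgN. Qed.

Lemma has_limit0M f g : has_limit0 f -> has_limit0 g ->
  has_limit0 (fun h => f h * g h).
Proof. by move=> [a fa] [b gb]; exists (a * b); exact: cvgM. Qed.

Lemma has_limit0V f : f h @[h --> (0 : R)^'] --> (1 : R) ->
  has_limit0 (fun h => (f h)^-1).
Proof. by move=> f1; exists 1^-1; exact: cvgV (oner_neq0 R) f1. Qed.

(** Nearly all denominators below are brought to this shape; their limit 1 makes them nonzero for
    small [h] and their inverses convergent. *)
Lemma cvg_1B_mul f : has_limit0 f -> (1 - h * f h) @[h --> (0 : R)^'] --> (1 : R).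
Proof.
move=> [l fl]; rewrite -[X in _ --> X]subr0 -{2}(mul0r l).
apply: cvgB; first exact: cvg_cst.
by apply: cvgM fl; exact: nbhs_dnbhs.
Qed.

Lemma near0_neq0 f : f h @[h --> (0 : R)^'] --> (1 : R) ->
  \forall h \near (0 : R)^', f h != 0.
Proof. by move=> f1; apply: cvgr_neq0 f1 _; exact: oner_neq0. Qed.

End HasLimit0.

Ltac has_limit0_tac := repeat lazymatch goal with
  | |- has_limit0 (fun h => h) => exact: has_limit0_id
  | |- has_limit0 (fun=> ?c) => exact: has_limit0_cst
  | |- has_limit0 (fun h => @?f h + @?g h) => apply: (@has_limit0D _ f g)
  | |- has_limit0 (fun h => @?f h * @?g h) => apply: (@has_limit0M _ f g)
  | |- has_limit0 (fun h => - @?f h) => apply: (@has_limit0N _ f)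
  | |- has_limit0 _ => assumption
  end.

Lemma first_order_criterion (R : realType) (A : 'M[R]_3)
    (phi Phi : R -> R -> R -> R -> R) (F : R -> 'rV[R]_3 -> 'rV[R]_3) :
  (\forall h \near (0 : R)^', generates_S1 (phi h) (Phi h) (F h)) ->
  (\forall h \near (0 : R)^', volume_preserving (F h)) ->
  (forall x i, exists r : R -> R, has_limit0 r /\
     \forall h \near (0 : R)^',
       F h x 0 i = x 0 i + h * linear_field A x 0 i + h ^+ 2 * r h) ->
  yields_first_order_vp_integrator (linear_field A) phi Phi.
Proof.
move=> genF volF expF; exists F.
have step x : exists2 C, 0 <= C & \forall h \near (0 : R)^',
    `|F h x - x - h *: linear_field A x| <= C * `|h| ^+ 2.
  apply: (@near_rV_le _ _ (0 : R)^' _ _ (fun h => `|h| ^+ 2)) => [h|i].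
    exact: sqr_ge0.
  have [r [[l rl] Fr]] := expF x i.
  exists (`|l| + 1); first by rewrite addr_ge0.
  have ltl : `|l| < `|l| + 1 by rewrite ltrDl.
  have rb := cvgr_norm_le l rl _ ltl.
  near=> h.
  have Fh : F h x 0 i = x 0 i + h * linear_field A x 0 i + h ^+ 2 * r h.
    by near: h; exact: Fr.
  have rh : `|r h| <= `|l| + 1 by near: h; exact: rb.
  move: Fh; rewrite !mxE => ->.
  rewrite [X in `|X|](_ : _ = h ^+ 2 * r h); last by ring.
  by rewrite normrM normrX mulrC ler_wpM2r.
split => // x.
- have [C C0 FC] := step x.
  apply/cvgrPdist_le => e e0; near=> h.
  have h0 : h != 0 by near: h; exact: nbhs_dnbhs_neq.
  (* This makes [C * |h|] at most [e]; adding 1 keeps the divisor positive when [C = 0]. *)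
  have hC : `|h| <= e / (C + 1).
    by near: h; apply: dnbhs0_le; rewrite divr_gt0// ltr_wpDl.
  have Fh : `|F h x - x - h *: linear_field A x| <= C * `|h| ^+ 2 by near: h.
  rewrite distrC -[X in _ - X](scalerK h0) -scalerBr normrZ normfV.
  rewrite ler_pdivrMl ?normr_gt0// (le_trans Fh)// expr2 mulrA mulrC.
  rewrite ler_wpM2l//; move: hC; rewrite ler_pdivlMr ?ltr_wpDl// => hC.
  by have := normr_ge0 h; lra.
- move=> y soly; have [C1 C10 H1] := step x.
  have [C2 C20 H2] := solution_expansion soly.
  exists (C1 + C2); near=> h.
  have H1h : `|F h x - x - h *: linear_field A x| <= C1 * `|h| ^+ 2 by near: h.
  have H2h : `|y h - x - h *: linear_field A x| <= C2 * `|h| ^+ 2.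
    by near: h; exact: nbhs_dnbhs.
  rewrite mulrDl (le_trans _ (lerD H1h H2h))// (le_trans _ (ler_normB _ _))//.
  by rewrite -!(addrA _ (- x)) -!opprD opprB addrA subrK.
Unshelve. all: by end_near.
Qed.

(** * Solving the generating equations when they are triangular *)

Definition row3 (R : realType) (a b c : R) : 'rV[R]_3 := \row_j nth 0 [:: a; b; c] j.

Lemma row3P (R : realType) (u v : 'rV[R]_3) :
  u 0 o1 = v 0 o1 -> u 0 o2 = v 0 o2 -> u 0 o3 = v 0 o3 -> u = v.
Proof.
by move=> e1 e2 e3; apply/rowP => i; case: (ord3P i) => ->.
Qed.

(** Each slice is a polynomial of degree at most two in the differentiated variable, so the
    derivability clauses hold and the three equations become algebraic. *)
Lemma S1_relation_quadratic (R : realType) (phi Phi : R -> R -> R -> R)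
    (x X : 'rV[R]_3) (p p' P P' q q' Q Q' r r' S S' : R) :
  (forall t, phi (x 0 o1) (X 0 o1) t = p + q * t + r * t ^+ 2) ->
  (forall t, phi (x 0 o1) t (x 0 o2) = p' + q' * t + r' * t ^+ 2) ->
  (forall t, Phi t (X 0 o1) (X 0 o2) = P + Q * t + S * t ^+ 2) ->
  (forall t, Phi (x 0 o1) (X 0 o1) t = P' + Q' * t + S' * t ^+ 2) ->
  S1_relation phi Phi x X <->
  [/\ x 0 o3 = q + 2 * r * x 0 o2,
      q' + 2 * r' * X 0 o1 = Q + 2 * S * x 0 o1 &
      X 0 o3 = - (Q' + 2 * S' * X 0 o2)].
Proof.
move=> /is_derive_quadratic d2 /is_derive_quadratic d1.
move=> /is_derive_quadratic D1 /is_derive_quadratic D2.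
rewrite /S1_relation !derive1E.
rewrite (@derive_val _ _ _ _ _ _ _ (d2 _)) (@derive_val _ _ _ _ _ _ _ (d1 _)).
rewrite (@derive_val _ _ _ _ _ _ _ (D1 _)) (@derive_val _ _ _ _ _ _ _ (D2 _)).
by split=> [[]|].
Qed.

(** Serves to divide an equation by the coefficient of its unknown; an equivalence is needed because
    the relation must be exactly the graph of the map. *)
Lemma eq_scaled (R : realType) (c a b a' b' : R) :
  c != 0 -> a - b = c * (a' - b') -> a = b <-> a' = b'.
Proof.
move=> c0 E; split=> [/eqP|/eqP]; rewrite -subr_eq0.
  by rewrite E mulf_eq0 (negbTE c0) subr_eq0 => /eqP.
by move=> /eqP a'b'; apply/eqP; rewrite -subr_eq0 E a'b' mulr0.
Qed.

(** Forward substitution: each equation may be solved using the coordinates of [X] already found. *)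
Lemma row3_triangular (R : realType) (X : 'rV[R]_3) (a b c : R) (P Q S : Prop) :
  (P <-> X 0 o1 = a) -> (X 0 o1 = a -> Q <-> X 0 o2 = b) ->
  (X 0 o1 = a -> X 0 o2 = b -> S <-> X 0 o3 = c) ->
  [/\ P, Q & S] <-> X = row3 a b c.
Proof.
move=> Pa Qb Sc; split=> [[/Pa Xa /(Qb Xa) Xb /(Sc Xa Xb) Xc]|XE].
  by apply: row3P; rewrite !mxE.
have Xa : X 0 o1 = a by rewrite XE mxE.
have Xb : X 0 o2 = b by rewrite XE mxE.
by split; [exact/Pa | exact/(Qb Xa) | apply/(Sc Xa Xb); rewrite XE mxE].
Qed.

(** * The explicit maps of the two generating forms *)

Section Integrators.
Context (R : realType) (A : 'M[R]_3).

Local Notation a11 := (A o1 o1). Local Notation a12 := (A o1 o2).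
Local Notation a13 := (A o1 o3). Local Notation a21 := (A o2 o1).
Local Notation a22 := (A o2 o2). Local Notation a23 := (A o2 o3).
Local Notation a31 := (A o3 o1). Local Notation a32 := (A o3 o2).
Local Notation a33 := (A o3 o3).

Definition map_i (h : R) (x : 'rV[R]_3) : 'rV[R]_3 :=
  let x1 := x 0 o1 in let x2 := x 0 o2 in let x3 := x 0 o3 in
  let X2 := (x2 + h * k2 A h * (a21 * x1 + a23 * x3)) / k1 A h in
  let X1 := x1 + h * (a11 * x1 + a12 * X2 + a13 * x3) in
  row3 X1 X2 (x3 + h * (a31 * X1 + a32 * X2 + a33 * x3)).

Lemma map_i_linear h : linear (map_i h).
Proof. by move=> k u v; apply: row3P; rewrite !mxE /=; ring. Qed.

Hypothesis divergence_free : a11 + a22 + a33 = 0.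
Hypothesis a13_neq0 : a13 != 0.

Lemma k1_factor h : k1 A h = (1 + h * a11) * (1 + h * a33).
Proof.
rewrite /k1 (_ : a22 = 0 - a11 - a33); first by ring.
by rewrite -divergence_free; ring.
Qed.

Lemma map_i_volume_preserving h : k1 A h != 0 -> volume_preserving (map_i h).
Proof.
move=> k10; apply: linear_volume_preserving; first exact: map_i_linear.
rewrite det_mx33 !mxE /=.
move: k10 (k1_factor h); move: (k1 A h) (k2 A h) => K1 K2 K10 E.
by field: E.
Qed.

Lemma generates_i h : h != 0 -> k1 A h != 0 ->
  k1 A h * a13 + h * a23 * a12 * k2 A h != 0 ->
  generates_S1 (phi_i A h) (Phi_i A h) (map_i h).
Proof.
move=> h0 k10 D0 x X.
set x1 := x 0 o1; set x2 := x 0 o2; set x3 := x 0 o3.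
set X1 := X 0 o1; set X2 := X 0 o2; set X3 := X 0 o3.
pose r := k2 A h / k1 A h.
pose D := h * a13 + h ^+ 2 * a23 * a12 * r.
have phi2 t : phi_i A h x1 X1 t = 0
    + (X1 - x1 - h * a11 * x1 - h ^+ 2 * a21 * a12 * x1 * r) / D * t
    + - (a12 / (k1 A h * a13 + h * a23 * a12 * k2 A h) / 2) * t ^+ 2.
  by rewrite /phi_i -/r -/D; ring.
have phi1 t : phi_i A h x1 t x2 = phi_i A h x1 0 x2 + x2 / D * t + 0 * t ^+ 2.
  by rewrite /phi_i -/r -/D; ring.
have Phi1 t : Phi_i A h t X1 X2 = Phi_i A h 0 X1 X2
    + ((1 + h * a11) / (h * a13) * (1 + h * a33) * X2
       - 2 * X1 * (h * a23 * k2 A h) / (2 * k3 A h)) * t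
    + ((1 + h * a11) * (h * a23 * k2 A h) - h ^+ 2 * a13 * a21 * k2 A h)
      / (2 * k3 A h) * t ^+ 2.
  by rewrite /Phi_i; ring.
have Phi2 t : Phi_i A h x1 X1 t = Phi_i A h x1 X1 0
    + (- ((X1 - x1 - h * a11 * x1) / (h * a13)) * (1 + h * a33) - h * a31 * X1) * t
    + (- (h * a32 / 2) + a12 / (2 * a13) * (1 + h * a33)) * t ^+ 2.
  by rewrite /Phi_i; ring.
apply: (iff_trans (S1_relation_quadratic phi2 phi1 Phi1 Phi2)).
rewrite -/x1 -/x2 -/x3 -/X1 -/X2 -/X3.
rewrite /map_i -/x1 -/x2 -/x3.
rewrite /D /r /k3.
move: k10 D0 (k1_factor h); move: (k1 A h) (k2 A h) => K1 K2 K10 D0 K1E.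
(* The denominator of [phi_i], which is also a factor of [k3], is a nonzero multiple of the quantity
   assumed nonzero in [D0]. *)
have DE : h * a13 + h ^+ 2 * a23 * a12 * (K2 / K1)
    = h / K1 * (K1 * a13 + h * a23 * a12 * K2) by field.
rewrite (_ : K2 / K1 * (h ^+ 2 * a12 * a23) = h ^+ 2 * a23 * a12 * (K2 / K1));
  last by ring.
rewrite DE.
pose E := K1 * a13 + h * a23 * a12 * K2.
apply: row3_triangular => [|X1E|X1E X2E].
(* The scaling factor is the coefficient of the unknown [X1]; in the next equation it is that of
   [X2]. *)
- apply: (@eq_scaled _ (- (K1 / (h * E)))).
    by rewrite oppr_eq0 !mulf_neq0 ?invr_neq0 ?mulf_neq0.
  by rewrite -/X1 /E; field; rewrite ?K10 ?h0 ?D0.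
- apply: (@eq_scaled _ (- (K1 / (h * a13)))).
    by rewrite oppr_eq0 !mulf_neq0 ?invr_neq0 ?mulf_neq0.
  rewrite -/X1 in X1E; rewrite -/X2 X1E.
  (* The vanishing trace enters here, through [K1E]: the coefficient of [X2] involves exactly the
     [K1] by which [map_i] divides. *)
  rewrite (_ : (1 + h * a11) / (h * a13) * (1 + h * a33) = K1 / (h * a13)).
    by rewrite /E; field; rewrite ?K10 ?h0 ?D0 ?a13_neq0.
  by rewrite K1E; field; rewrite ?h0 ?a13_neq0.
- apply: (@eq_scaled _ 1); first exact: oner_neq0.
  rewrite -/X1 in X1E; rewrite -/X2 in X2E; rewrite -/X3 X1E X2E; field.
  by rewrite ?K10 ?h0 ?a13_neq0.
Qed.

(** Up to the factor [- 1 / (l1 A h * (h * a13))], this is the coefficient of [X2] in the second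
    equation of case (ii), rewritten with the trace identity. *)
Definition den_ii h := k1 A h - h ^+ 2 * (a13 * a31 + a12 * a21).

(** [X1] is an explicit Euler step. It is eliminated from the third coordinate by [(X1 - (1 + h *
    a11) * x1) / (h * a13) = x3 + a12 / a13 * x2]. *)
Definition map_ii (h : R) (x : 'rV[R]_3) : 'rV[R]_3 :=
  let x1 := x 0 o1 in let x2 := x 0 o2 in let x3 := x 0 o3 in
  let X2 := (x2 + h * (a21 * x1 + a23 * x3)) / den_ii h in
  row3 (x1 + h * (a11 * x1 + a12 * x2 + a13 * x3)) X2
    (((1 + h * a33) * (x3 + a12 / a13 * (x2 - X2)) + h * a31 * x1 + h * a32 * X2
      + h * (a12 / a13) * (a21 * x1 + a22 * X2)) / l1 A h).

Lemma map_ii_linear h : linear (map_ii h).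
Proof. by move=> k u v; apply: row3P; rewrite !mxE /=; ring. Qed.

Lemma map_ii_volume_preserving h :
  den_ii h != 0 -> l1 A h != 0 -> volume_preserving (map_ii h).
Proof.
move=> m0 l0; apply: linear_volume_preserving; first exact: map_ii_linear.
rewrite det_mx33 !mxE /=.
(* Clearing the quotient [a12 / a13] inside [l1] turns it into this denominator. *)
have lE : a13 - h * a12 * a23 != 0.
  rewrite (_ : _ - _ = l1 A h * a13); first by rewrite mulf_neq0.
  by rewrite /l1; field.
(* The factor [l1] cancels from the determinant, and the trace identity turns the remaining
   numerator into [den_ii h]. *)
transitivity (((1 + h * a11) * (1 + h * a33) - h ^+ 2 * (a13 * a31 + a12 * a21))
    / den_ii h); last by rewrite -k1_factor divff.
move: m0; rewrite /l1; move: (den_ii h) => m m0.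
by field; rewrite ?a13_neq0 ?m0 ?lE.
Qed.

Lemma generates_ii h : h != 0 -> den_ii h != 0 -> l1 A h != 0 ->
  generates_S1 (phi_ii A h) (Phi_ii A h) (map_ii h).
Proof.
move=> h0 m0 l0 x X.
set x1 := x 0 o1; set x2 := x 0 o2; set x3 := x 0 o3.
set X1 := X 0 o1; set X2 := X 0 o2; set X3 := X 0 o3.
have phi2 t : phi_ii A h x1 X1 t = 0
    + (X1 - (1 + h * a11) * x1) / (h * a13) * t
    + - (1 / 2 * (a12 / a13)) * t ^+ 2.
  by rewrite /phi_ii; ring.
have phi1 t : phi_ii A h x1 t x2 = phi_ii A h x1 0 x2 + x2 / (h * a13) * t + 0 * t ^+ 2.
  by rewrite /phi_ii; ring.
have Phi1 t : Phi_ii A h t X1 X2 = Phi_ii A h 0 X1 X2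
    + - (1 / l1 A h) * (- (1 + h * a33) * (1 + h * a11) / (h * a13) * X2
      + h * a31 * X2 + h * (a12 / a13) * a21 * X2
      + 1 / (h * a13) * (h * a23 * (2 * X1 / (2 * h * a13)))) * t
    + - (1 / l1 A h) * (1 / (h * a13)) *
      (h * a21 / 2 - h * a23 * ((1 + h * a11) / (2 * h * a13))) * t ^+ 2.
  by rewrite /Phi_ii; ring.
have Phi2 t : Phi_ii A h x1 X1 t = Phi_ii A h x1 X1 0
    + - (1 / l1 A h) * ((1 + h * a33) * ((X1 - (1 + h * a11) * x1) / (h * a13))
      + h * a31 * x1 + h * (a12 / a13) * a21 * x1) * t
    + - (1 / l1 A h) * (- (1 + h * a33) * (1 / 2 * (a12 / a13))
      + 1 / 2 * h * a32 + h * (a12 / a13) * (1 / 2 * a22)) * t ^+ 2.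
  by rewrite /Phi_ii; ring.
apply: (iff_trans (S1_relation_quadratic phi2 phi1 Phi1 Phi2)).
rewrite -/x1 -/x2 -/x3 -/X1 -/X2 -/X3.
rewrite /map_ii -/x1 -/x2 -/x3.
have mE : den_ii h = (1 + h * a11) * (1 + h * a33) - h ^+ 2 * (a13 * a31 + a12 * a21).
  by rewrite -k1_factor.
have lE : a13 - h * a12 * a23 != 0.
  rewrite (_ : _ - _ = l1 A h * a13); first by rewrite mulf_neq0.
  by rewrite /l1; field.
apply: row3_triangular => [|X1E|X1E X2E].
- apply: (@eq_scaled _ (- (h * a13)^-1)).
    by rewrite oppr_eq0 invr_neq0 ?mulf_neq0.
  by rewrite -/X1; field; rewrite ?h0 ?a13_neq0.
- apply: (@eq_scaled _ (- (den_ii h / (l1 A h * (h * a13))))).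
    by rewrite oppr_eq0 !mulf_neq0 ?invr_neq0 ?mulf_neq0.
  rewrite -/X1 in X1E; rewrite -/X2 X1E.
  (* Multiplying out removes the division by [den_ii h] before [mE] expands it. *)
  rewrite [RHS](_ : _ = - ((den_ii h * X2 - (x2 + h * (a21 * x1 + a23 * x3)))
    / (l1 A h * (h * a13)))); last by field; rewrite ?m0 ?l0 ?h0 ?a13_neq0.
  by rewrite mE /l1; field; rewrite ?h0 ?a13_neq0 ?lE.
- apply: (@eq_scaled _ 1); first exact: oner_neq0.
  rewrite -/X1 in X1E; rewrite -/X2 in X2E; rewrite -/X3 X1E -X2E.
  by field; rewrite ?l0 ?h0 ?a13_neq0.
Qed.

(** * Limits of the denominators and expansions of the maps in [h] *)

Lemma cvg_k1 : k1 A h @[h --> (0 : R)^'] --> (1 : R).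
Proof.
have -> : k1 A = fun h => 1 - h * (a22 - h * a11 * a33).
  by apply/funext => h; rewrite /k1; ring.
by apply: cvg_1B_mul; has_limit0_tac.
Qed.

Lemma cvg_1a22 : (1 - h * a22) @[h --> (0 : R)^'] --> (1 : R).
Proof. by apply: cvg_1B_mul; has_limit0_tac. Qed.

Lemma cvg_k2 : k2 A h @[h --> (0 : R)^'] --> (1 : R).
Proof.
have H := has_limit0V cvg_1a22.
have -> : k2 A = fun h => 1 - h * (- (h * (a11 * a33 / (1 - h * a22)))).
  by apply/funext => h; rewrite /k2; ring.
by apply: cvg_1B_mul; has_limit0_tac.
Qed.

Lemma cvg_den_ii : den_ii h @[h --> (0 : R)^'] --> (1 : R).
Proof.
have -> : den_ii = fun h => 1 - h * (a22 - h * a11 * a33 + h * (a13 * a31 + a12 * a21)).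
  by apply/funext => h; rewrite /den_ii /k1; ring.
by apply: cvg_1B_mul; has_limit0_tac.
Qed.

Lemma cvg_l1 : l1 A h @[h --> (0 : R)^'] --> (1 : R).
Proof.
have -> : l1 A = fun h => 1 - h * (a12 / a13 * a23).
  by apply/funext => h; rewrite /l1; ring.
by apply: cvg_1B_mul; has_limit0_tac.
Qed.

(** Division by [a13] normalises the limit to 1, so that [near0_neq0] applies. *)
Lemma cvg_den_i :
  (k1 A h * a13 + h * a23 * a12 * k2 A h) / a13 @[h --> (0 : R)^'] --> (1 : R).
Proof.
have K2 : has_limit0 (k2 A) by exists 1; exact: cvg_k2.
have -> : (fun h => (k1 A h * a13 + h * a23 * a12 * k2 A h) / a13) =
    fun h => 1 - h * (a22 - h * (a11 * a33) - a23 * a12 / a13 * k2 A h).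
  by apply/funext => h; rewrite /k1; move: (k2 A h) => K; field.
by apply: cvg_1B_mul; has_limit0_tac.
Qed.

Lemma map_i_expansion x i : exists r : R -> R, has_limit0 r /\
  \forall h \near (0 : R)^',
    map_i h x 0 i = x 0 i + h * linear_field A x 0 i + h ^+ 2 * r h.
Proof.
have K1 := has_limit0V cvg_k1.
have K1N := near0_neq0 cvg_k1.
have K2 : has_limit0 (k2 A) by exists 1; exact: cvg_k2.
have Q := has_limit0V cvg_1a22.
set x1 := x 0 o1; set x2 := x 0 o2; set x3 := x 0 o3.
pose s := a21 * x1 + a23 * x3.
(* k1 = 1 - h d, X2 = x2 + h g1, and g1 = s + a22 x2 + h g2. *)
pose d h := a22 - h * (a11 * a33).
pose g1 h := (d h * x2 + k2 A h * s) * (k1 A h)^-1.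
pose g2 h := (- (a11 * a33 * x2) + h * (a11 * a33 * (1 - h * a22)^-1) * s
   + d h * (s + a22 * x2)) * (k1 A h)^-1.
have G1 : has_limit0 g1 by rewrite /g1 /d; has_limit0_tac.
have G2 : has_limit0 g2 by rewrite /g2 /d; has_limit0_tac.
have X2E : \forall h \near (0 : R)^',
    (x2 + h * k2 A h * s) / k1 A h = x2 + h * g1 h.
  near=> h; have k10 : k1 A h != 0 by near: h; exact: K1N.
  rewrite /g1 /d; move: k10; rewrite /k1; move: (k2 A h) => K k10; field.
  exact: k10.
case: (ord3P i) => ->.
(* [X2] enters this coordinate with a factor [h], so its expansion to first order suffices; only the
   second coordinate needs [g2]. *)
- exists (fun h => a12 * g1 h); split; first by has_limit0_tac.
  near=> h; rewrite !mxE /=; rewrite -/x1 -/x2 -/x3 -/s.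
  have -> : (x2 + h * k2 A h * s) / k1 A h = x2 + h * g1 h by near: h; exact: X2E.
  by ring.
- exists g2; split => //.
  near=> h; rewrite !mxE /=; rewrite -/x1 -/x2 -/x3 -/s.
  have k10 : k1 A h != 0 by near: h; exact: K1N.
  have q0 : 1 - h * a22 != 0 by near: h; exact: (near0_neq0 cvg_1a22).
  rewrite /g2 /d /k2 /s; move: k10; rewrite /k1 => k10; field.
  by rewrite k10 q0.
- exists (fun h => a31 * (a11 * x1 + a12 * (x2 + h * g1 h) + a13 * x3) + a32 * g1 h).
  split; first by has_limit0_tac.
  near=> h; rewrite !mxE /=; rewrite -/x1 -/x2 -/x3 -/s.
  have -> : (x2 + h * k2 A h * s) / k1 A h = x2 + h * g1 h by near: h; exact: X2E.
  by ring.
Unshelve. all: by end_near.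
Qed.

Lemma map_ii_expansion x i : exists r : R -> R, has_limit0 r /\
  \forall h \near (0 : R)^',
    map_ii h x 0 i = x 0 i + h * linear_field A x 0 i + h ^+ 2 * r h.
Proof.
have M := has_limit0V cvg_den_ii.
have L := has_limit0V cvg_l1.
set x1 := x 0 o1; set x2 := x 0 o2; set x3 := x 0 o3.
pose s := a21 * x1 + a23 * x3.
pose b := a12 / a13.
(* den_ii = 1 - h c, c = a22 + h e, X2 = x2 + h g1, and
   g1 = s + a22 x2 + h g2. *)
pose e := a13 * a31 + a12 * a21 - a11 * a33.
pose c h := a22 + h * e.
pose g1 h := (c h * x2 + s) * (den_ii h)^-1.
pose g2 h := (e * x2 + c h * (s + a22 * x2)) * (den_ii h)^-1.
have G1 : has_limit0 g1 by rewrite /g1 /c; has_limit0_tac.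
have G2 : has_limit0 g2 by rewrite /g2 /c; has_limit0_tac.
have mE h : den_ii h = 1 - h * c h by rewrite /den_ii /k1 /c /e; ring.
have X2E : \forall h \near (0 : R)^',
    (x2 + h * s) / den_ii h = x2 + h * g1 h /\ g1 h = s + a22 * x2 + h * g2 h.
  near=> h.
  have m0 : den_ii h != 0 by near: h; exact: (near0_neq0 cvg_den_ii).
  by rewrite /g1 /g2; move: m0; rewrite mE /c => m0; split; field.
case: (ord3P i) => ->.
(* The first coordinate is exactly the Euler step. *)
- exists (fun=> 0); split; first by has_limit0_tac.
  by near=> h; rewrite !mxE /=; ring.
- exists g2; split => //.
  near=> h; rewrite !mxE /=; rewrite -/x1 -/x2 -/x3 -/s.
  have [-> ->] : (x2 + h * s) / den_ii h = x2 + h * g1 h /\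
      g1 h = s + a22 * x2 + h * g2 h.
    by near: h; exact: X2E.
  by rewrite /s; ring.
(* The witness comes from subtracting [l1 A h] times the Euler step from the numerator. The term
   [- h * b * a23 * x3] cancels, since [l1 A h = 1 - h * b * a23], and the last summand is what this
   product leaves at order [h ^+ 2]. *)
- exists (fun h => (- (b * g2 h) - a33 * (b * g1 h) + a32 * g1 h + b * a22 * g1 h
     + b * a23 * (a31 * x1 + a32 * x2 + a33 * x3)) * (l1 A h)^-1).
  split; first by has_limit0_tac.
  near=> h; rewrite !mxE /=; rewrite -/x1 -/x2 -/x3 -/s -/b.
  have [-> g1E] : (x2 + h * s) / den_ii h = x2 + h * g1 h /\
      g1 h = s + a22 * x2 + h * g2 h.
    by near: h; exact: X2E.
  have l0 : l1 A h != 0 by near: h; exact: (near0_neq0 cvg_l1).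
  rewrite g1E; move: l0; rewrite /l1 -/b /s; move: (g2 h) b => G B l0.
  by field.
Unshelve. all: by end_near.
Qed.

End Integrators.

Theorem proposition4p1 (R : realType) (A : 'M[R]_3)
    (divergence_free : A o1 o1 + A o2 o2 + A o3 o3 = 0)
    (a13_neq0 : A o1 o3 != 0) :
  yields_first_order_vp_integrator (linear_field A) (phi_i A) (Phi_i A) /\
  yields_first_order_vp_integrator (linear_field A) (phi_ii A) (Phi_ii A).
Proof.
split.
- apply: (@first_order_criterion _ _ _ _ (map_i A)).
  + near=> h; apply: generates_i => //.
    * by near: h; exact: nbhs_dnbhs_neq.
    * by near: h; exact: near0_neq0 (@cvg_k1 _ A).
    * have : (k1 A h * A o1 o3 + h * A o2 o3 * A o1 o2 * k2 A h) / A o1 o3 != 0.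
        by near: h; exact: near0_neq0 (cvg_den_i a13_neq0).
      by apply: contra_neq => ->; rewrite mul0r.
  + near=> h; apply: map_i_volume_preserving => //.
    by near: h; exact: near0_neq0 (@cvg_k1 _ A).
  + exact: map_i_expansion.
- apply: (@first_order_criterion _ _ _ _ (map_ii A)).
  + near=> h; apply: generates_ii => //.
    * by near: h; exact: nbhs_dnbhs_neq.
    * by near: h; exact: near0_neq0 (@cvg_den_ii _ A).
    * by near: h; exact: near0_neq0 (@cvg_l1 _ A).
  + near=> h; apply: map_ii_volume_preserving => //.
    * by near: h; exact: near0_neq0 (@cvg_den_ii _ A).
    * by near: h; exact: near0_neq0 (@cvg_l1 _ A).
  + exact: map_ii_expansion.
Unshelve. all: by end_near.
Qed.
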